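(* Let $M\in\mathbb{N}$ and $n\in\mathbb{N}$, and let $\beta\in(1,\beta_n)$. Then $$\Delta_{M,\frac{1}{n+1}}\subseteq \Delta_{M,\beta}(x)\quad\text{for all } x\in\Big(0,\frac{M}{\beta-1}\Big).$$
   Context: $\mathbb{N}=\{1,2,3,\ldots\}$. For $n\in\mathbb{N}$, $\beta_n$ denotes the unique zero of $f_n(x)=x^{n+1}-x^n-1$ in the interval $(1,2)$. For $M\in\mathbb{N}$, $\beta\in(1,M+1]$ and $x\in[0,\frac{M}{\beta-1}]$, the set of $\beta$-expansions of $x$ is $$\Sigma_{\beta,M}(x)=\Big\{(a_i)_{i\ge1}\in\{0,\ldots,M\}^{\mathbb{N}}:\sum_{i=1}^{\infty}\frac{a_i}{\beta^i}=x\Big\}.$$ For $(a_i)\in\{0,\ldots,M\}^{\mathbb{N}}$ and $k\in\{0,\ldots,M\}$, the $k$-frequency is $\mathrm{freq}_k(a_i)=\lim_{N\to\infty}\frac{\#\{1\le i\le N:a_i=k\}}{N}$, when the limit exists. $\Delta_M=\{(p_k)_{k=0}^M\in\mathbb{R}^{M+1}:p_k\ge0,\ \sum_{k=0}^M p_k=1\}$. For $\epsilon>0$, $\Delta_{M,\epsilon}=\{(p_k)_{k=0}^M\in\mathbb{R}^{M+1}:0\le p_k\le 1-\epsilon,\ \sum_{k=0}^M p_k=1\}$. Finally, $$\Delta_{M,\beta}(x)=\Big\{(p_k)\in\Delta_M:\exists (a_i)\in\Sigma_{\beta,M}(x)\text{ such that }\mathrm{freq}_k(a_i)=p_k\ \forall\,0\le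 k\le M\Big\}$$ (the frequencies being required to exist). *)

(* Defs.v *)
From mathcomp Require Import all_boot all_order all_algebra.
From mathcomp Require Import all_classical all_reals all_analysis.

Set Implicit Arguments.
Unset Strict Implicit.
Unset Printing Implicit Defensive.

Import Order.TTheory GRing.Theory Num.Theory.
Import numFieldNormedType.Exports.

Local Open Scope classical_set_scope.
Local Open Scope ring_scope.

Definition f_ (R : realType) (n : nat) (x : R) : R := x ^+ n.+1 - x ^+ n - 1.

(* The zero of f_ n in (1, 2); it exists and is unique as soon as 0 < n, by
   beta_P and beta_unique below. The default value 0 is then irrelevant. *)
Definition beta_ (R : realType) (n : nat) : R :=
  xget 0 [set x : R | 1 < x < 2 /\ f_ n x = 0].

Lemma f_increasing (R : realType) (n : nat) (x y : R) :
  1 < x -> x < y -> f_ n x < f_ n y.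
Proof.
move=> x1 xy; rewrite /f_ ltrD2r !exprSr -[X in _ - X < _]mulr1.
rewrite -[X in _ < _ - X]mulr1 -!mulrBr.
have x0 : 0 < x by apply: lt_trans x1.
apply: (@le_lt_trans _ _ (y ^+ n * (x - 1))).
  by rewrite ler_wpM2r ?subr_ge0 ?(ltW x1)// lerXn2r ?nnegrE ?(ltW x0)// ltW//;
    apply: lt_trans xy.
by rewrite ltr_pM2l ?ltrD2r// exprn_gt0// (lt_trans x0).
Qed.

Lemma beta_P (R : realType) (n : nat) : (0 < n)%N ->
  1 < beta_ R n < 2 /\ f_ n (beta_ R n) = 0.
Proof.
move=> n0.
suff [x xP] : exists x : R, 1 < x < 2 /\ f_ n x = 0.
  by rewrite /beta_; case: xgetP => [y -> //|/(_ x)].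
pose p : {poly R} := 'X ^+ n.+1 - 'X ^+ n - 1.
have pE x : p.[x] = f_ n x by rewrite /p /f_ !hornerE.
have f1 : f_ n (1 : R) = -1 by rewrite /f_ !expr1n subrr add0r.
have f2 : 0 < f_ n (2 : R).
  rewrite /f_ exprSr -[X in _ - X - _]mulr1 -mulrBr (_ : 2 - 1 = 1 :> R).
    by rewrite mulr1 subr_gt0 exprn_egt1 ?ltr1n// -lt0n.
  by rewrite mulr2n addrK.
have [||x /andP[x1 x2] /rootP] := @poly_ivt R p 1 2.
- by rewrite ler1n.
- by rewrite !pE f1 (ltW f2) oppr_le0 ler01.
rewrite pE => fx; exists x; split=> //; apply/andP; split.
  rewrite lt_neqAle x1 andbT; apply/eqP => e; move: fx; rewrite -e f1.
  by move/eqP; rewrite oppr_eq0 oner_eq0.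
rewrite lt_neqAle x2 andbT; apply/eqP => e; move: fx; rewrite e => h.
by rewrite h ltxx in f2.
Qed.

Lemma beta_unique (R : realType) (n : nat) (x : R) : (0 < n)%N ->
  1 < x < 2 -> f_ n x = 0 -> x = beta_ R n.
Proof.
move=> n0 /andP[x1 _] fx; have [/andP[b1 _] fb] := beta_P R n0.
case: (ltgtP x (beta_ R n)) => // /f_increasing => [/(_ n x1)|/(_ n b1)];
  by rewrite fx fb ltxx.
Qed.

(* A sequence (a_i)_{i >= 1} of digits is encoded as a : nat -> 'I_M.+1 with
   a i standing for a_{i+1}. *)
Definition expansions (R : realType) (M : nat) (beta x : R) :
    set (nat -> 'I_M.+1) :=
  [set a : nat -> 'I_M.+1 |
    series (fun i => (a i)%:R / beta ^+ i.+1 : R) @ \oo --> x].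
Arguments expansions {R} M beta x _.

(* The k-frequency of a exists and is equal to q. *)
Definition has_freq (R : realType) (M : nat) (a : nat -> 'I_M.+1)
    (k : 'I_M.+1) (q : R) : Prop :=
  #|[pred i : 'I_N | a i == k]|%:R / N%:R @[N --> \oo] --> q.

Definition Delta (R : realType) (M : nat) : set 'rV[R]_M.+1 :=
  [set p : 'rV[R]_M.+1 |
    (forall k, 0 <= p 0 k) /\ \sum_k p 0 k = 1].
Arguments Delta R M _ : clear implicits.

Definition Delta_eps (R : realType) (M : nat) (eps : R) : set 'rV[R]_M.+1 :=
  [set p : 'rV[R]_M.+1 |
    (forall k, 0 <= p 0 k <= 1 - eps) /\ \sum_k p 0 k = 1].
Arguments Delta_eps {R} M eps _.

Definition Delta_beta (R : realType) (M : nat) (beta x : R) :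
    set 'rV[R]_M.+1 :=
  [set p : 'rV[R]_M.+1 |
    Delta R M p /\
    exists2 a, expansions M beta x a & forall k, has_freq a k (p 0 k)].
Arguments Delta_beta {R} M beta x _.

(* Main.v *)
Require Import Defs.
From mathcomp Require Import all_boot all_order all_algebra.
From mathcomp Require Import all_classical all_reals all_analysis.
From mathcomp Require Import zify ring lra.

Import Order.TTheory GRing.Theory Num.Theory.
Import numFieldNormedType.Exports.

Local Open Scope classical_set_scope.
Local Open Scope ring_scope.

(** Let [d = beta - 1].  A digit sequence [a] is an expansion of [x] as soon as
    the orbit [u 0 = d * x], [u N.+1 = beta * u N - d * a N] stays bounded
    ([bounded_orbit_expansion]).  Using the digit [a] pushes [u] away from [a]
    by the factor [beta], so the task is to keep [u] inside [0, M] while the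
    digits are used with the prescribed frequencies [p].

    _Two digits._  Suppose that only [k] and [l] are used, and let
    [v = (u - k) / (l - k)]: digit [k] acts by [v -> beta * v] and digit [l] by
    [v -> beta * v - d].  The greedy rule uses [l] as soon as the result is
    nonnegative, that is for [v >= d / beta].  The orbit soon enters and never
    leaves [v < d]; from then on the point is below [d ^ 2] after a digit [l],
    and it takes at least [n] digits [k] to come back to [d / beta], because
    [beta ^ n * d < 1]; this inequality is what [beta < beta_ n] means.  So the greedy rule gives [k] the frequency
    [n / n.+1] at least, with [k] and [l] in either order.  Shifting the
    threshold by a small margin [eta] keeps [v] in [[eta, 1 - eta]], away from
    the two fixed points ([greedy_step]).  From any other place of
    [[eta, M - eta]] the zone of the pair is reached by moving with bounded
    steps towards the midpoint of [k] and [l] ([approach_step]).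

    _All digits._  Let [D N k = N * p k - #{i < N | a i = k}] be the debt towards
    digit [k].  At the times [N = j ^ 2] the pair is reset: [k] is the digit of
    largest debt and [l] the next one.  As [p k <= n / n.+1], the average of the
    debts under [p] is at most their average under the weights [n / n.+1] on [k]
    and [1 / n.+1] on [l] ([top_pair_ge]), and the greedy rule for [(k, l)] does
    at least as well as these weights, up to a bounded number of steps.  Hence,
    in the spirit of Blackwell's approachability, the squared length of the debt
    vector grows by [O(j ^ 2)] during the [j]-th block: the cross term is a
    bounded multiple of the debt, which is at most [j ^ 2], and the quadratic
    term is the square of the length [2 * j + 1] of the block.  At time [j ^ 2]
    the debts are thus [O(j ^ (3/2)) = o(j ^ 2)], which is the claim on
    frequencies ([debt_sublinear], [debt_has_freq]).

    The losses during a block are accounted for by a [potential] on the orbit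
    point, whose decrease dominates the loss of each step ([potential_step]), and is
    over a whole block at most a constant times the largest debt
    ([potential_drop]). *)

(** * The hypothesis on the base *)

(** The condition with [1 - 2 * eta] bounds the steps towards a zone by the
    width of that zone.  The last one is [beta ^ n * (beta - 1) < 1] with room for the
    perturbation of the greedy rule: it says that a point below
    [beta - 1 + eta], moved by one digit [l], is still below the same bound
    after [n] digits [k]. *)
Definition margin {R : realType} (beta : R) (n : nat) (eta : R) : Prop :=
  [/\ 1 < beta, 0 < eta, (beta - 1) * (1 + eta) <= 1 - 2 * eta
    & beta ^+ n * ((beta - 1) ^+ 2 + beta * eta) <= beta - 1 + eta].

(** [f_ n] increases and vanishes at [beta_ R n], so [f_ n beta < 0]. *)
Lemma beta_expn_lt1 (R : realType) (n : nat) (beta : R) :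
  (0 < n)%N -> 1 < beta < beta_ R n -> (beta - 1) * beta ^+ n < 1.
Proof.
move=> n0 /andP[b1 bn]; have [_ fb] := beta_P R n0.
have := f_increasing n b1 bn; rewrite fb /f_ exprS; lra.
Qed.

Lemma exists_margin (R : realType) (n : nat) (beta e : R) :
  1 < beta < 2 -> (beta - 1) * beta ^+ n < 1 -> 0 < e ->
  exists2 eta, margin beta n eta & eta <= e.
Proof.
move=> /andP[b1 b2] bn e0.
have p0 : 0 < beta ^+ n by rewrite exprn_gt0//; lra.
pose d := beta - 1.
(* [e1] turns the condition on the steps into an equality; [e2] does so for the
     last condition with the term [eta] on its right-hand side dropped. *)
pose e1 := (1 - d) / (d + 2).
pose e2 := d * (1 - d * beta ^+ n) / (beta ^+ n * beta).
have d0 : 0 < d by rewrite /d; lra.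
have e10 : 0 < e1 by rewrite divr_gt0// /d; lra.
have e20 : 0 < e2.
  rewrite divr_gt0// mulr_gt0//; first by rewrite subr_gt0.
  lra.
exists (Num.min e (Num.min e1 e2)); last by rewrite ge_min lexx.
set eta := Num.min _ _.
have h0 : 0 < eta by rewrite !lt_min e0 e10.
have h1 : eta <= e1 by rewrite !ge_min lexx ?orbT.
have h2 : eta <= e2 by rewrite !ge_min lexx ?orbT.
split=> //.
  move: h1; rewrite ler_pdivlMr; last lra.
  rewrite -/d; lra.
move: h2; rewrite ler_pdivlMr; last by rewrite mulr_gt0//; lra.
rewrite -/d; set q := beta ^+ n in bn p0 *.
rewrite mulrDr expr2; lra.
Qed.

Lemma margin_bounds {R : realType} {beta eta : R} {n : nat} :
  margin beta n eta ->
  [/\ 0 < beta - 1, beta - 1 < 1, 0 < eta, 0 < (beta - 1) * eta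
    & beta - 1 + eta <= 1 - eta].
Proof.
case=> b1 h0 h1 _; have d0 : 0 < beta - 1 by rewrite subr_gt0.
have : 0 < (beta - 1) * eta by rewrite mulr_gt0.
by split=> //; lra.
Qed.

(** * The greedy rule for two digits *)

(** The greedy rule for the pair (0, 1) in the coordinate [v], perturbed so that
    the smallest value produced by the digit 1 is [eta] instead of 0. *)
Definition threshold {R : realType} (beta eta : R) : R :=
  (beta - 1 + eta) / beta.

Lemma thresholdE {R : realType} (beta eta : R) :
  1 < beta -> beta * threshold beta eta = beta - 1 + eta.
Proof.
by move=> b1; rewrite /threshold mulrC divfK// gt_eqF// (lt_trans _ b1).
Qed.

(** The number of digits 0 that must come before the next digit 1, capped at
    [n]: summing indicators makes the one-step change immediate. *)
Definition wait {R : realType} (beta eta : R) (n : nat) (v : R) : R :=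
  \sum_(i < n) (beta ^+ i * v < threshold beta eta)%R%:R.

Lemma wait_ge0 {R : realType} (beta eta : R) n v : 0 <= wait beta eta n v.
Proof. by apply: sumr_ge0 => i _; rewrite ler0n. Qed.

Lemma wait_le {R : realType} (beta eta : R) n v : wait beta eta n v <= n%:R.
Proof.
rewrite -[n in n%:R]card_ord -sum1_card natr_sum ler_sum// => i _.
by rewrite ler_nat leq_b1.
Qed.

Lemma wait_eq0 {R : realType} (beta eta : R) n v :
  1 < beta -> 0 <= v -> threshold beta eta <= v -> wait beta eta n v = 0.
Proof.
move=> b1 v0 cv; apply: big1 => i _; rewrite ltNge (le_trans cv)// ler_peMl//.
by rewrite exprn_ege1 1?ltW.
Qed.

Lemma wait_mul {R : realType} (beta eta : R) n v :
  wait beta eta n v - 1 <= wait beta eta n (beta * v).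
Proof.
rewrite /wait; case: n => [|m]; first by rewrite !big_ord0; lra.
rewrite big_ord_recl /= big_ord_recr /= expr0 mul1r.
under [X in _ <= X + _]eq_bigr do rewrite mulrA -exprSr.
set s := \sum_(_ < _) _.
have : ((v < threshold beta eta)%R%:R : R) <= 1.
  by rewrite -[1]/(1%:R) ler_nat leq_b1.
have : 0 <= ((beta ^+ m * (beta * v) < threshold beta eta)%R%:R : R).
  by rewrite ler0n.
lra.
Qed.

Lemma wait_full {R : realType} (beta eta : R) n v : 1 < beta -> 0 <= v ->
  beta ^+ n * v < beta - 1 + eta -> wait beta eta n v = n%:R.
Proof.
move=> b1 v0 h; rewrite /wait -[n in n%:R]card_ord -sum1_card natr_sum.
apply: eq_bigr => i _; suff -> : beta ^+ i * v < threshold beta eta by [].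
rewrite -(@ltr_pM2l _ beta) ?thresholdE//; last by rewrite (lt_trans _ b1).
apply: le_lt_trans h; rewrite mulrA -exprS ler_wpM2r// ler_weXn2l//.
exact: ltW.
Qed.

Definition zone {R : realType} (eta v : R) : bool := eta <= v <= 1 - eta.

(** Points above [beta - 1 + eta] are left once and for all; while the orbit is
    there, several digits 1 may come in a row, and the decrease of [excess]
    counts them. *)
Definition excess {R : realType} (beta eta v : R) : R :=
  if v < beta - 1 + eta then 0 else v.

Lemma excess_itv {R : realType} (beta eta v : R) :
  0 < eta -> zone eta v -> 0 <= excess beta eta v <= 1 - eta.
Proof. by rewrite /excess => h0 /andP[? ?]; case: ifP; lra. Qed.

(** Each step either counts down the wait (digit 0), or is a digit 1 that resets
    the wait from 0 to [n], or belongs to the initial descent, which is paid for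
    by a definite decrease of [excess]. *)
Lemma greedy_step {R : realType} {beta eta : R} {n : nat} (v : R) :
  margin beta n eta -> zone eta v ->
  exists b : bool, let v' := beta * v - (beta - 1) * b%:R in zone eta v' /\
  [\/ [/\ b = false, wait beta eta n v - 1 <= wait beta eta n v'
        & excess beta eta v' <= excess beta eta v],
      [/\ b = true, wait beta eta n v' = wait beta eta n v + n%:R
        & excess beta eta v' <= excess beta eta v]
    | excess beta eta v' <= excess beta eta v - (beta - 1) * eta].
Proof.
move=> mg; have [d0 d1 h0 dh h4] := margin_bounds mg; have [b1 _ _ h5] := mg.
have b0 : 0 < beta by lra.
move=> /andP[v0 v1]; have [vc|cv] := ltP v (threshold beta eta).
  exists false; rewrite mulr0 subr0 /=.
  have vb : beta * v < beta - 1 + eta by rewrite -thresholdE// ltr_pM2l.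
  have vb' : v <= beta * v by rewrite ler_peMl//; lra.
  split; first by rewrite /zone; lra.
  apply: Or31; split=> //; first exact: wait_mul.
  by rewrite /excess vb; case: ifP; lra.
exists true; rewrite mulr1 /=.
have vb : eta <= beta * v - (beta - 1).
  by move: cv; rewrite -(ler_pM2l b0) thresholdE//; lra.
have dv : 0 <= (beta - 1) * (1 - v - eta) by rewrite mulr_ge0//; lra.
split; first by rewrite /zone; lra.
have [vs|sv] := ltP v (beta - 1 + eta).
  apply: Or32; split=> //.
    rewrite (wait_eq0 _ _ _ v)//; last lra.
    rewrite add0r wait_full//; first lra.
    (* The image is below the image (beta - 1)^2 + beta * eta of the upper bound. *)
    apply: lt_le_trans h5; rewrite ltr_pM2l ?exprn_gt0//.
    have : 0 < beta * (beta - 1 + eta - v) by rewrite mulr_gt0//; lra.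
    by rewrite expr2; lra.
  by rewrite /excess !ifT//; lra.
apply: Or33.
rewrite /excess (ltNge v) sv /=; case: ifP => _; last lra.
have : 0 <= (beta - 1) * (1 - eta) by rewrite mulr_ge0//; lra.
lra.
Qed.

(** * One step of the rule for a pair of digits *)

(** The region of the orbit: a point at distance [eta] from both ends can still
    be steered in bounded time. *)
Definition core {R : realType} (M : nat) (eta u : R) : bool :=
  eta <= u <= M%:R - eta.

Lemma digit_below {R : realType} {M : nat} {eta u : R} :
  0 < eta -> core M eta u -> exists a : 'I_M.+1, eta <= u - a%:R <= 1 + eta.
Proof.
move=> h0 /andP[u0 uM].
have /truncn_itv : 0 <= u - eta by lra.
set a := Num.truncn _; rewrite -[a.+1]addn1 natrD => /andP[a0 a1].
have aM : (a < M.+1)%N by rewrite ltnS -(@ler_nat R); lra.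
by exists (Ordinal aM) => /=; lra.
Qed.

(** The symmetry [u -> M - u], [a -> M - a] reduces this to [digit_below]. *)
Lemma digit_above {R : realType} {M : nat} {eta u : R} :
  0 < eta -> core M eta u -> exists a : 'I_M.+1, eta <= a%:R - u <= 1 + eta.
Proof.
move=> h0 uJ; have /(digit_below h0)[a] : core M eta (M%:R - u).
  by move: uJ; rewrite /core; lra.
exists (rev_ord a) => /=; rewrite subSS natrB; last by rewrite -ltnS.
lra.
Qed.

(** The affine coordinate that turns the digits [k] and [l] into 0 and 1; the
    order of [k] and [l] is free, so that either can be the majority digit. *)
Definition relpos {R : realType} {M : nat} (k l : 'I_M.+1) (u : R) : R :=
  (u - k%:R) / (l%:R - k%:R).

Definition midpoint {R : realType} {M : nat} (k l : 'I_M.+1) : R :=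
  (k%:R + l%:R) / 2.

(** A measure of the steps that remain before the greedy rule for [(k, l)] is in
    its steady regime: first the way to the zone, then the initial descent. *)
Definition lag {R : realType} {M : nat} (beta eta : R) (k l : 'I_M.+1) (u : R) :=
  if zone eta (relpos k l u) then excess beta eta (relpos k l u)
  else 1 + `|u - midpoint k l|.

Lemma digit_gap {R : realType} {M : nat} {k l : 'I_M.+1} :
  k != l -> 1 <= `|l%:R - k%:R : R|.
Proof.
move=> kl; have {}kl : (k != l :> nat) by [].
rewrite -ler_sqr ?nnegrE// expr1n real_normK ?num_real//.
have [h|h|h] := ltngtP k l; last by rewrite h eqxx in kl.
- have : (k%:R + 1 <= l%:R :> R) by rewrite natr1 ler_nat.
  nra.
- have : (l%:R + 1 <= k%:R :> R) by rewrite natr1 ler_nat.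
  nra.
Qed.

(** In the coordinate [u], the zone is symmetric around the midpoint. *)
Lemma zone_relpos {R : realType} {M : nat} (eta : R) (k l : 'I_M.+1) (u : R) :
  k != l -> zone eta (relpos k l u) =
    (`|u - midpoint k l| <= (1 / 2 - eta) * `|l%:R - k%:R|).
Proof.
move=> /(@digit_gap R) s1; rewrite /relpos /midpoint.
set s := l%:R - k%:R in s1 *; have s0 : s != 0 by rewrite -normr_gt0; lra.
have -> : u - (k%:R + l%:R) / 2 = ((u - k%:R) / s - 1 / 2) * s.
  rewrite mulrBl divfK// /s; lra.
rewrite normrM ler_pM2r ?normr_gt0// ler_norml /zone.
by apply/idP/idP; lra.
Qed.

(** Distinct digits differ by 1 at least, so the margin [eta] in the relative
    coordinate is a margin of at least [eta] in the coordinate [u]. *)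
Lemma core_zone {R : realType} {M : nat} (eta : R) (k l : 'I_M.+1) (u : R) :
  0 < eta -> k != l -> zone eta (relpos k l u) -> core M eta u.
Proof.
move=> h0 kl; rewrite zone_relpos// /midpoint.
have := @digit_gap R _ _ _ kl; set s := l%:R - k%:R => s1.
have hs : 0 <= eta * (`|s| - 1) by rewrite mulr_ge0//; lra.
have k0 : 0 <= k%:R :> R by []. have l0 : 0 <= l%:R :> R by [].
have kM : k%:R <= M%:R :> R by rewrite ler_nat -ltnS.
have lM : l%:R <= M%:R :> R by rewrite ler_nat -ltnS.
rewrite ler_norml /core; have [s0|s0] := leP 0 s.
  by rewrite ger0_norm// in s1 hs *; rewrite /s in s1 hs *; lra.
by rewrite ltr0_norm// in s1 hs *; rewrite /s in s1 hs *; lra.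
Qed.

(** A digit at distance between [eta] and [1 + eta] on the far side of [u] moves
    [u] towards the midpoint by at least [(beta - 1) * eta], and by at most
    [1 - 2 * eta], so that it cannot jump over the zone. *)
Lemma approach_step {R : realType} {beta eta : R} {n M : nat} (k l : 'I_M.+1)
    (u : R) : margin beta n eta -> k != l -> core M eta u ->
    ~~ zone eta (relpos k l u) ->
  exists a : 'I_M.+1, let u' := beta * u - (beta - 1) * a%:R in
    core M eta u' /\ lag beta eta k l u' <= lag beta eta k l u - (beta - 1) * eta.
Proof.
move=> mg kl uJ uZ; have [d0 d1 h0 dh h4] := margin_bounds mg.
have [b1 _ h5 _] := mg; have := uZ; rewrite zone_relpos//.
have := @digit_gap R _ _ _ kl; set s := l%:R - k%:R => s1 hZ.
set m := midpoint k l in hZ *; set h := _ * `|s| in hZ.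
have h1 : 1 - 2 * eta <= 2 * h.
  have : 0 <= (1 / 2 - eta) * (`|s| - 1) by rewrite mulr_ge0//; lra.
  rewrite /h; lra.
have endJ e : `|e| <= h -> core M eta (m + e).
  move=> eh; apply: (core_zone _ k l) => //.
  by rewrite zone_relpos// -/m -/s -/h (addrC m) addrK.
have /andP[_ hi] : core M eta (m + h) by apply: endJ; rewrite ger0_norm//; lra.
have /andP[lo _] : core M eta (m - h).
  by apply: endJ; rewrite normrN ger0_norm//; lra.
(* On arrival in the zone the lag falls from at least 1 to at most [1 - eta]. *)
have lagE u' : core M eta u' ->
    (~~ zone eta (relpos k l u') ->
      `|u' - m| <= `|u - m| - (beta - 1) * eta) ->
    core M eta u' /\ lag beta eta k l u' <= lag beta eta k l u - (beta - 1) * eta.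
  move=> u'J hu'; split=> //; rewrite /lag (negbTE uZ) -/m; case: ifP => Z.
    have := excess_itv beta _ _ h0 Z; have := normr_ge0 (u - m).
    have : (beta - 1) * eta <= eta by rewrite ler_piMl//; lra.
    lra.
  by have := hu' (negbT Z); lra.
move: uJ => /andP[u0 uM]; rewrite -ltNge in hZ.
have [um|mu] := ltP u m.
- have [a /andP[a0 a1]] := digit_below h0 (introT andP (conj u0 uM)).
  have w0 : 0 <= (beta - 1) * (u - a%:R - eta) by rewrite mulr_ge0//; lra.
  have w1 : 0 <= (beta - 1) * (1 + eta - (u - a%:R)) by rewrite mulr_ge0//; lra.
  rewrite ltr0_norm in hZ; last lra.
  exists a; apply: lagE; first by rewrite /core; lra.
  rewrite zone_relpos// -/m -/s -/h -ltNge => hZ'.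
  rewrite (ltr0_norm (x := u - m)); last lra.
  have [q|q] := leP 0 (beta * u - (beta - 1) * a%:R - m).
    by rewrite ger0_norm// in hZ'; lra.
  rewrite ltr0_norm//; lra.
- have [a /andP[a0 a1]] := digit_above h0 (introT andP (conj u0 uM)).
  have w0 : 0 <= (beta - 1) * (a%:R - u - eta) by rewrite mulr_ge0//; lra.
  have w1 : 0 <= (beta - 1) * (1 + eta - (a%:R - u)) by rewrite mulr_ge0//; lra.
  rewrite ger0_norm in hZ; last lra.
  exists a; apply: lagE; first by rewrite /core; lra.
  rewrite zone_relpos// -/m -/s -/h -ltNge => hZ'.
  rewrite (ger0_norm (x := u - m)); last lra.
  have [q|q] := leP 0 (beta * u - (beta - 1) * a%:R - m); last first.
    by rewrite ltr0_norm// in hZ'; lra.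
  rewrite ger0_norm//; lra.
Qed.

Lemma pair_step {R : realType} {beta eta : R} {n M : nat} (k l : 'I_M.+1) (u : R) :
  margin beta n eta -> k != l -> core M eta u ->
  exists a : 'I_M.+1, let u' := beta * u - (beta - 1) * a%:R in
  core M eta u' /\
  [\/ [/\ a = k,
          wait beta eta n (relpos k l u) - 1 <= wait beta eta n (relpos k l u')
        & lag beta eta k l u' <= lag beta eta k l u],
      [/\ a = l,
          wait beta eta n (relpos k l u') = wait beta eta n (relpos k l u) + n%:R
        & lag beta eta k l u' <= lag beta eta k l u]
    | lag beta eta k l u' <= lag beta eta k l u - (beta - 1) * eta].
Proof.
move=> mg kl uJ; have [d0 d1 h0 dh h4] := margin_bounds mg.
have [Z|Z] := boolP (zone eta (relpos k l u)); last first.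
  have [a [aJ alag]] := approach_step k l u mg kl uJ Z.
  by exists a; split=> //; apply: Or33.
have [b [Z' hb]] := greedy_step _ mg Z; exists (if b then l else k) => u'.
have E : relpos k l u' = beta * relpos k l u - (beta - 1) * b%:R.
  rewrite /u' /relpos; have := @digit_gap R _ _ _ kl.
  have [|s0 _] := eqVneq (l%:R - k%:R : R) 0; first by move=> ->; rewrite normr0; lra.
  by case: b {Z' hb u'} => /=; field.
rewrite /lag !E Z Z'; split; first by apply: core_zone kl _; rewrite ?E.
case: hb => [[-> ? ?]|[-> ? ?]|?]; [exact: Or31|exact: Or32|exact: Or33].
Qed.

(** * Debts against the greedy rule *)

Definition top_pair {R : realType} {M : nat} (D : 'I_M.+1 -> R)
    (kl : 'I_M.+1 * 'I_M.+1) : Prop :=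
  [/\ kl.1 != kl.2, D kl.2 <= D kl.1 & forall i, i != kl.1 -> D i <= D kl.2].

Lemma exists_top_pair {R : realType} {M : nat} (D : 'I_M.+1 -> R) :
  (0 < M)%N -> exists kl, top_pair D kl.
Proof.
move=> M0; case: (@Order.TotalTheory.arg_maxP _ _ _ ord0 xpredT D) => // k _ kmax.
pose l0 : 'I_M.+1 := if k == ord0 then ord_max else ord0.
have l0k : l0 != k.
  rewrite /l0; case: (eqVneq k ord0) => [->|]; last by rewrite eq_sym.
  by rewrite -val_eqE /= -lt0n.
case: (@Order.TotalTheory.arg_maxP _ _ _ l0 (fun i => i != k) D) => // l lk lmax.
by exists (k, l); split=> //=; [rewrite eq_sym|exact: kmax].
Qed.

(** Under the constraint [p k <= n / n.+1], the best possible average of [D] puts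
    the weight [n / n.+1] on the largest entry and the rest on the next one. *)
Lemma top_pair_ge {R : realType} {M : nat} (n : nat) (D p : 'I_M.+1 -> R) kl :
  top_pair D kl -> (forall k, 0 <= p k <= 1 - n.+1%:R^-1) -> \sum_k p k = 1 ->
  n.+1%:R * \sum_i D i * p i <= n%:R * D kl.1 + D kl.2.
Proof.
case: kl => k l [/= kl Dlk Dl] p01 p1.
have : \sum_i D i * p i <= D k * p k + D l * (1 - p k).
  rewrite -p1 [X in X - _](bigD1 k)//= [X in D l * X]addrAC subrr add0r.
  rewrite (bigD1 k)//= lerD2l mulr_sumr ler_sum// => i ik.
  by rewrite ler_wpM2r ?Dl//; case/andP: (p01 i).
have n0 : 0 < n.+1%:R :> R by [].
rewrite -(ler_pM2l n0) => /le_trans; apply.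
have /andP[_ pk] := p01 k.
have : 0 <= (D k - D l) * (n.+1%:R * (1 - n.+1%:R^-1 - p k)).
  by rewrite !mulr_ge0// ?subr_ge0.
by rewrite !mulrBr mulr1 divff ?gt_eqF// -natr1; lra.
Qed.

(** The wait is weighted by the difference of the two debts, since this is what
    a digit [l] in place of [k] loses.  The lag is weighted by a bound [W] of all
    the debts: while it decreases nothing is known about the digit, and the
    factor makes a decrease by [(beta - 1) * eta] worth [4 * n.+1 * W], at
    least any loss together with any change of the wait term. *)
Definition potential {R : realType} {M : nat} (beta eta : R) (n : nat)
    (D : 'I_M.+1 -> R) (W : R) (k l : 'I_M.+1) (u : R) : R :=
  4 * n.+1%:R * W / ((beta - 1) * eta) * lag beta eta k l u
  - (D k - D l) * wait beta eta n (relpos k l u).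

(** The digit depends on [k], [l] and [u] only, not on [D]: the same rule serves
    for a whole block during which the debts change. *)
Lemma potential_step {R : realType} {beta eta : R} {n M : nat} (k l : 'I_M.+1)
    (u : R) : margin beta n eta -> k != l -> core M eta u ->
  exists a : 'I_M.+1, let u' := beta * u - (beta - 1) * a%:R in
  core M eta u' /\
  forall (D : 'I_M.+1 -> R) (W : R), D l <= D k -> (forall i, `|D i| <= W) ->
    n%:R * D k + D l - n.+1%:R * D a
      <= potential beta eta n D W k l u - potential beta eta n D W k l u'.
Proof.
move=> mg kl uJ; have [d0 d1 h0 dh h4] := margin_bounds mg.
have [a [u'J H]] := pair_step k l u mg kl uJ; exists a; split=> // D W Dlk DW.
rewrite /potential; set u' := beta * u - _ in u'J H *.
set c := 4 * _ * W / _.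
have W0 : 0 <= W by rewrite (le_trans _ (DW k)).
have n0 : 0 <= n%:R :> R by [].
have c0 : 0 <= c by rewrite /c !mulr_ge0// invr_ge0 ltW.
have cE : c * ((beta - 1) * eta) = 4 * n.+1%:R * W by rewrite /c divfK// gt_eqF.
have := wait_ge0 beta eta n (relpos k l u').
have := wait_le beta eta n (relpos k l u).
move: H; set r := wait _ _ _ _; set r' := wait _ _ _ _.
set L := lag _ _ _ _ u; set L' := lag _ _ _ _ u'.
rewrite -natr1 in cE *.
move=> [[-> hr hL]|[-> hr hL]|hL] hr0 hr1; have := ler_wpM2l c0 hL.
- have : 0 <= (D k - D l) * (r' - (r - 1)) by rewrite mulr_ge0// subr_ge0.
  lra.
- rewrite hr; lra.
rewrite mulrBr cE.
have := ler_norml (D k) W; have := ler_norml (D l) W; have := ler_norml (D a) W.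
rewrite !DW => /esym/andP[a1 a2] /esym/andP[l1 l2] /esym/andP[k1 k2].
have : 0 <= (D k - D l) * r' by rewrite mulr_ge0// subr_ge0.
have : 0 <= (D k - D l) * (n%:R - r) by rewrite mulr_ge0// subr_ge0.
have : 0 <= n%:R * (D l + W) by rewrite mulr_ge0//; lra.
have : 0 <= n%:R * (W - D k) by rewrite mulr_ge0//; lra.
have : 0 <= n%:R * (D a + W) by rewrite mulr_ge0//; lra.
lra.
Qed.

Lemma potential_drop {R : realType} {beta eta : R} {n M : nat} (D : 'I_M.+1 -> R)
    (W : R) (k l : 'I_M.+1) (u u' : R) :
  margin beta n eta -> core M eta u -> D l <= D k -> (forall i, `|D i| <= W) ->
  potential beta eta n D W k l u - potential beta eta n D W k l u' <=
    W * (4 * n.+1%:R / ((beta - 1) * eta) * M.+1%:R + 2 * n%:R).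
Proof.
move=> mg uJ Dlk DW; have [d0 d1 h0 dh h4] := margin_bounds mg.
have W0 : 0 <= W by rewrite (le_trans _ (DW k)).
rewrite /potential [_ * W / _]mulrAC.
set c := _ / _; have c0 : 0 <= c by rewrite /c !mulr_ge0// invr_ge0 ltW.
clearbody c.
have := wait_ge0 beta eta n (relpos k l u).
have := wait_ge0 beta eta n (relpos k l u').
have := wait_le beta eta n (relpos k l u').
set r' := wait _ _ _ (relpos k l u'); set r := wait _ _ _ _ => r'n r'0 r0.
have L0 : 0 <= lag beta eta k l u'.
  rewrite /lag; case: ifP => [/(excess_itv beta _ _ h0)/andP[]//|_].
  by rewrite addr_ge0.
have L1 : lag beta eta k l u <= M.+1%:R.
  rewrite /lag -natr1; case: ifP => [/(excess_itv beta _ _ h0)/andP[_ h]|_].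
    have : 0 <= M%:R :> R by [].
    lra.
  rewrite addrC lerD2r /midpoint.
  have k0 : 0 <= k%:R :> R by []. have l0 : 0 <= l%:R :> R by [].
  have kM : k%:R <= M%:R :> R by rewrite ler_nat -ltnS.
  have lM : l%:R <= M%:R :> R by rewrite ler_nat -ltnS.
  move: uJ => /andP[? ?]; rewrite ler_norml; lra.
have := ler_norml (D k) W; have := ler_norml (D l) W.
rewrite !DW => /esym/andP[l1 l2] /esym/andP[k1 k2].
have : 0 <= c * W * (M.+1%:R - lag beta eta k l u).
  by rewrite !mulr_ge0// subr_ge0.
have : 0 <= c * W * lag beta eta k l u' by rewrite !mulr_ge0.
have : 0 <= (D k - D l) * r' by rewrite mulr_ge0// subr_ge0.
have : 0 <= (D k - D l) * r by rewrite mulr_ge0// subr_ge0.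
have : (D k - D l) * r' <= 2 * W * n%:R by apply: ler_pM => //; lra.
lra.
Qed.

(** * Growth of the debts *)

Lemma square_bracket (N : nat) : exists j : nat, (j ^ 2 <= N < j.+1 ^ 2)%N.
Proof.
elim: N => [|N [j /andP[jN Nj]]]; first by exists 0%N.
have [h|h] := ltnP N.+1 (j.+1 ^ 2); first by exists j; rewrite h (leq_trans jN).
by exists j.+1; rewrite h /= (leq_ltn_trans Nj)// ltn_exp2r.
Qed.

Lemma drift_le {R : realType} (D : nat -> R) :
  (forall N, `|D N.+1 - D N| <= 1) ->
  forall N m, `|D (N + m)%N - D N| <= m%:R.
Proof.
move=> D1 N; elim=> [|m IH]; first by rewrite addn0 subrr normr0.
rewrite addnS -natr1 (le_trans (ler_distD (D (N + m)%N) _ _))//.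
by rewrite addrC lerD.
Qed.

(** The square of the debt vector grows in the [j]-th block by a cross term, at
    most [2 * K * j ^ 2] by assumption, and a quadratic term, at most
    [(2 * j + 1) ^ 2] for each digit. *)
Lemma squared_debt_le {R : realType} {M : nat} (D : nat -> 'I_M.+1 -> R) (K : R) :
  0 <= K -> (forall k, D 0%N k = 0) ->
  (forall N k, `|D N.+1 k - D N k| <= 1) ->
  (forall j, \sum_k D (j ^ 2)%N k * (D (j.+1 ^ 2)%N k - D (j ^ 2)%N k)
     <= K * (j ^ 2)%:R) ->
  forall j, \sum_k D (j ^ 2)%N k ^+ 2 <= (2 * K + 4 * M.+1%:R) * j%:R ^+ 3.
Proof.
move=> K0 D0 D1 DK; elim=> [|j IH].
  by rewrite big1 ?expr0n ?mulr0// => k _; rewrite D0 expr0n.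
set E := D (j ^ 2)%N in IH DK *; have {DK} := DK j; rewrite -/E.
set F := D _ => DK.
have -> : \sum_k F k ^+ 2 = \sum_k E k ^+ 2 + 2 * \sum_k E k * (F k - E k)
    + \sum_k (F k - E k) ^+ 2.
  rewrite mulr_sumr -!big_split /=; apply: eq_bigr => k _; ring.
have h : \sum_k (F k - E k) ^+ 2 <= M.+1%:R * (2 * j%:R + 1) ^+ 2.
  rewrite -[X in X%:R * _]card_ord -sum1_card natr_sum mulr_suml ler_sum// => k _.
  rewrite mul1r -[_ ^+ 2]real_normK ?num_real// ler_sqr ?nnegrE; last 2 first.
  - by rewrite normr_ge0.
  - by rewrite addr_ge0// mulr_ge0.
  have -> : F k = D (j ^ 2 + (2 * j + 1))%N k by rewrite /F; congr (D _ k); lia.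
  by rewrite (le_trans (drift_le (fun N => D N k) (fun N => D1 N k) _ _))// natrD natrM.
have j0 : 0 <= j%:R :> R by [].
have M0 : 0 <= M.+1%:R :> R by [].
move: DK; rewrite natrX -[j.+1%:R]natr1 => DK.
set m := M.+1%:R in h M0 IH *; set x := j%:R in h j0 IH DK *.
have q1 : 0 <= K * (2 * (x ^+ 2 * 2 + 3 * x + 1)).
  by rewrite !mulr_ge0// !addr_ge0// ?mulr_ge0// exprn_ge0.
have q2 : 0 <= m * (8 * x ^+ 2 + 8 * x + 3).
  by rewrite !mulr_ge0// !addr_ge0// ?mulr_ge0// exprn_ge0.
nra.
Qed.

(** At time [N], between [j ^ 2] and [j.+1 ^ 2], the squared debt is [O(j ^ 3)]
    while [N ^ 2 >= j ^ 4]. *)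
Lemma debt_sublinear {R : realType} {M : nat} (D : nat -> 'I_M.+1 -> R) (K : R) :
  0 <= K -> (forall k, D 0%N k = 0) ->
  (forall N k, `|D N.+1 k - D N k| <= 1) ->
  (forall j, \sum_k D (j ^ 2)%N k * (D (j.+1 ^ 2)%N k - D (j ^ 2)%N k)
     <= K * (j ^ 2)%:R) ->
  forall k, D N k / N%:R @[N --> \oo] --> (0 : R).
Proof.
move=> K0 D0 D1 DK k; have Q := squared_debt_le D K K0 D0 D1 DK.
set C := 2 * K + _ in Q.
have C0 : 0 <= C by rewrite addr_ge0// mulr_ge0.
apply/cvgr0Pnorm_lt => e e0.
have [j0 j0P] : exists j0 : nat, 2 * C + 8 < e ^+ 2 * j0%:R.
  exists (Num.truncn ((2 * C + 8) / e ^+ 2)).+1.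
  rewrite [ltRHS]mulrC -ltr_pdivrMr ?exprn_gt0//; exact: truncnS_gt.
near=> N.
have NJ : (j0.+1 ^ 2 <= N)%N by near: N; exact: nbhs_infty_ge.
have [j /andP[jN Nj]] := square_bracket N.
have jj : (j0 < j)%N by rewrite -ltnS -(@ltn_exp2r _ _ 2)// (leq_ltn_trans NJ).
have N0 : 0 < N%:R :> R by rewrite ltr0n (leq_trans _ NJ).
rewrite normrM normfV (ger0_norm (ltW N0)) ltr_pdivrMr//.
rewrite -ltr_sqr ?nnegrE ?normr_ge0 ?mulr_ge0 ?(ltW e0)//.
have j1 : 1 <= j%:R :> R by rewrite ler1n (leq_trans _ jj).
have b1 : D (j ^ 2)%N k ^+ 2 <= C * j%:R ^+ 3.
  apply: le_trans (Q j); rewrite (bigD1 k)//= lerDl sumr_ge0// => i _.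
  exact: sqr_ge0.
have b2 : (D N k - D (j ^ 2)%N k) ^+ 2 <= 4 * j%:R ^+ 2.
  have -> : 4 * j%:R ^+ 2 = (2 * j%:R) ^+ 2 :> R by ring.
  rewrite -[_ ^+ 2]real_normK ?num_real// ler_sqr ?nnegrE ?mulr_ge0//.
  rewrite -[in D N](subnKC jN).
  rewrite (le_trans (drift_le (fun N => D N k) (fun N => D1 N k) _ _))//.
  by rewrite -natrM ler_nat; lia.
have b3 : j%:R ^+ 2 <= N%:R :> R by rewrite -natrX ler_nat.
have b4 : e ^+ 2 * j0%:R <= e ^+ 2 * j%:R.
  by rewrite ler_pM2l ?exprn_gt0// ler_nat ltnW.
set x := j%:R in j1 b1 b2 b3 b4.
have b5 : e ^+ 2 * x ^+ 4 <= (e * N%:R) ^+ 2.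
  rewrite exprMn ler_pM2l ?exprn_gt0// -[4%N]/(2 * 2)%N exprM ler_sqr//.
    by rewrite nnegrE exprn_ge0//; lra.
  by rewrite nnegrE ltW.
apply: lt_le_trans b5; rewrite real_normK ?num_real//.
have x3 : 0 < x ^+ 3 by rewrite exprn_gt0//; lra.
have b6 : (2 * C + 8) * x ^+ 3 < e ^+ 2 * x ^+ 4.
  have : 0 < x ^+ 3 * (e ^+ 2 * x - (2 * C + 8)) by rewrite mulr_gt0//; lra.
  lra.
have b7 : 0 <= x ^+ 2 * (x - 1) by rewrite mulr_ge0 ?exprn_ge0//; lra.
have : 0 <= (2 * D (j ^ 2)%N k - D N k) ^+ 2 by exact: sqr_ge0.
lra.
Unshelve. all: by end_near. Qed.

(** * Expansions and frequencies *)

(** The remainder of the expansion after [N] digits is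
    [u N / ((beta - 1) * beta ^ N)]. *)
Lemma bounded_orbit_expansion {R : realType} {M : nat} (beta x B : R)
    (a : nat -> 'I_M.+1) (u : nat -> R) :
  1 < beta -> u 0%N = (beta - 1) * x ->
  (forall N, u N.+1 = beta * u N - (beta - 1) * (a N)%:R) ->
  (forall N, 0 <= u N <= B) -> expansions M beta x a.
Proof.
move=> b1 u0 uS uB; rewrite /expansions /=.
have d0 : 0 < beta - 1 by rewrite subr_gt0.
have b0 : 0 < beta by lra.
have tailE N : series (fun i => (a i)%:R / beta ^+ i.+1 : R) N
    = x - u N / (beta - 1) * beta^-1 ^+ N.
  elim: N => [|N IH].
    by rewrite /series /= big_geq// u0 expr0 mulr1 mulrC mulKf ?subrr// gt_eqF.
  rewrite seriesSr IH uS exprVn exprVn exprS.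
  field. rewrite !expf_neq0 ?gt_eqF//.
have zero : (fun N => B / (beta - 1) * beta^-1 ^+ N) @ \oo --> (0 : R).
  rewrite -[X in _ --> X](mulr0 (B / (beta - 1))); apply: cvgMr.
  by apply: cvg_expr; rewrite ger0_norm ?invr_ge0 ?(ltW b0)// invf_lt1.
apply: (@squeeze_cvgr _ _ _ _ (fun N => x - B / (beta - 1) * beta^-1 ^+ N)
  (fun=> x)).
- apply: nearW => N; rewrite tailE lerD2l lerN2 lerBlDr lerDl.
  have p0 : 0 <= beta^-1 ^+ N by rewrite exprn_ge0// invr_ge0 ltW.
  case/andP: (uB N) => u0N uBN.
  rewrite ler_wpM2r//= ?ler_pM2r ?invr_gt0//=.
  by rewrite !mulr_ge0// invr_ge0 ltW.
- by rewrite -[X in _ --> X]subr0; apply: cvgB => //; exact: cvg_cst.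
- exact: cvg_cst.
Qed.

Definition debt {R : realType} {M : nat} (p : 'I_M.+1 -> R) (a : nat -> 'I_M.+1)
    (N : nat) (k : 'I_M.+1) : R :=
  N%:R * p k - \sum_(i < N) (a i == k)%:R.

Lemma debtS {R : realType} {M : nat} (p : 'I_M.+1 -> R) (a : nat -> 'I_M.+1)
    (N : nat) (k : 'I_M.+1) :
  debt p a N.+1 k = debt p a N k + (p k - (a N == k)%:R).
Proof. rewrite /debt big_ord_recr /= -natr1; ring. Qed.

Lemma debt_drift {R : realType} {M : nat} (p : 'I_M.+1 -> R)
    (a : nat -> 'I_M.+1) (N : nat) (k : 'I_M.+1) :
  0 <= p k <= 1 -> `|debt p a N.+1 k - debt p a N k| <= 1.
Proof.
move=> ?; rewrite debtS addrAC subrr add0r ler_norml.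
by case: (a N == k) => /=; lra.
Qed.

Lemma debt_le {R : realType} {M : nat} (p : 'I_M.+1 -> R)
    (a : nat -> 'I_M.+1) (N : nat) (k : 'I_M.+1) :
  0 <= p k <= 1 -> `|debt p a N k| <= N%:R.
Proof.
move=> pk; have := drift_le (fun N => debt p a N k)
  (fun N => debt_drift p a N k pk) 0 N.
by rewrite add0n [debt p a 0 k]/debt big_ord0 mul0r !subr0.
Qed.

Lemma debt_has_freq {R : realType} {M : nat} (p : 'I_M.+1 -> R)
    (a : nat -> 'I_M.+1) (k : 'I_M.+1) :
  debt p a N k / N%:R @[N --> \oo] --> (0 : R) -> has_freq a k (p k).
Proof.
move=> h; rewrite /has_freq -[p k]subr0.
have : p k - debt p a N k / N%:R @[N --> \oo] --> p k - 0.
  by apply: cvgB => //; exact: cvg_cst.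
apply: cvg_trans; apply: near_eq_cvg; near=> N.
have N0 : N%:R != 0 :> R.
  by rewrite pnatr_eq0 -lt0n; near: N; exact: nbhs_infty_gt.
rewrite /debt -sum1_card natr_sum [X in _ = X / _]big_mkcond /=.
have -> : \sum_(i < N) (a i == k)%:R
    = \sum_(i < N) (if i \in [pred i : 'I_N | a i == k] then 1 else 0) :> R.
  by apply: eq_bigr => i _; rewrite inE; case: eqP.
by field.
Unshelve. all: by end_near. Qed.

(** * The orbit with prescribed frequencies *)

(** A controlled recursion in which the control chosen at time [j ^ 2], from the
    state at that time, is kept until the next square. *)
Lemma block_schedule {S I : Type} (x0 : S) (i0 : I) (next : I -> S -> S)
    (top : S -> I) :
  exists (x : nat -> S) (c : nat -> I),
    [/\ x 0%N = x0, forall N, x N.+1 = next (c N) (x N)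
      & forall j m, (m <= 2 * j)%N -> c (j ^ 2 + m)%N = top (x (j ^ 2)%N)].
Proof.
pose sq N := [exists j : 'I_N.+1, j ^ 2 == N]%N.
pose choice N (s : S * I) := if sq N then top s.1 else s.2.
pose st := fix st N := if N is N'.+1 then
  (next (choice N' (st N')) (st N').1, choice N' (st N')) else (x0, i0).
exists (fun N => (st N).1), (fun N => choice N (st N)); split=> // j.
elim=> [|m IH] mj.
  rewrite addn0 /choice ifT//; apply/existsP.
  have jj : (j < (j ^ 2).+1)%N by rewrite ltnS; nia.
  by exists (Ordinal jj).
rewrite -IH; last exact: ltnW.
rewrite addnS /choice ifF//; apply/negbTE/existsPn => -[i _] /=.
(* No square lies strictly between [j ^ 2] and [j.+1 ^ 2]. *)
by apply/eqP; have [|] := leqP i j; nia.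
Qed.

(** The rule for the pair chosen at time [j ^ 2] is run for the whole block.  Its
    potential, taken with the debts [D] at the start of the block and the bound
    [W = j ^ 2] on them, controls the product of [D] with the change of the
    debts, which is the cross term that [debt_sublinear] asks for. *)
Lemma balanced_orbit {R : realType} {beta eta : R} {n M : nat}
    (p : 'I_M.+1 -> R) (u0 : R) :
  margin beta n eta -> (0 < M)%N ->
  (forall k, 0 <= p k <= 1 - n.+1%:R^-1) -> \sum_k p k = 1 -> core M eta u0 ->
  exists (a : nat -> 'I_M.+1) (u : nat -> R), [/\ u 0%N = u0,
    forall N, u N.+1 = beta * u N - (beta - 1) * (a N)%:R,
    forall N, core M eta (u N)
    & forall k, debt p a N k / N%:R @[N --> \oo] --> (0 : R)].
Proof.
move=> mg M0 p01 p1 u0J.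
have pk k : 0 <= p k <= 1.
  by have /andP[-> /le_trans->] := p01 k; rewrite // gerBl invr_ge0.
have /choice[top topP] : forall D : 'I_M.+1 -> R, exists kl, top_pair D kl.
  by move=> D; exact: exists_top_pair.
have /choice[dig digP] : forall x : ('I_M.+1 * 'I_M.+1) * R,
    exists a : 'I_M.+1, x.1.1 != x.1.2 -> core M eta x.2 ->
    let u' := beta * x.2 - (beta - 1) * a%:R in core M eta u' /\
    forall (D : 'I_M.+1 -> R) (W : R), D x.1.2 <= D x.1.1 ->
      (forall i, `|D i| <= W) ->
      n%:R * D x.1.1 + D x.1.2 - n.+1%:R * D a
        <= potential beta eta n D W x.1.1 x.1.2 x.2
           - potential beta eta n D W x.1.1 x.1.2 u'.
  case=> [[k l] u] /=; have [/andP[kl uJ]|h] := boolP ((k != l) && core M eta u).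
    by have [a ?] := potential_step k l u mg kl uJ; exists a.
  by exists k => kl uJ; rewrite kl uJ in h.
(* The debts are part of the state because they determine the next pair. *)
pose next kl (s : R * ('I_M.+1 -> R)) : R * ('I_M.+1 -> R) :=
  (beta * s.1 - (beta - 1) * (dig (kl, s.1))%:R,
   fun k => s.2 k + (p k - (dig (kl, s.1) == k)%:R)).
have [x [c [x0 xS cE]]] :=
  block_schedule (u0, fun=> 0) (ord0, ord0) next (fun s => top s.2).
pose u N := (x N).1; pose a N := dig (c N, u N).
have uS N : u N.+1 = beta * u N - (beta - 1) * (a N)%:R by rewrite /u xS.
have xD N : (x N).2 = debt p a N.
  elim: N => [|N IH]; apply/funext => k.
    by rewrite x0 /debt big_ord0 mul0r subrr.
  by rewrite debtS -IH xS.
have cD j m : (m <= 2 * j)%N -> c (j ^ 2 + m)%N = top (debt p a (j ^ 2)%N).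
  by move=> mj; rewrite cE// xD.
have c_neq N : (c N).1 != (c N).2.
  have [j /andP[jN Nj]] := square_bracket N.
  rewrite -(subnKC jN) cD; first by case: (topP (debt p a (j ^ 2)%N)).
  by lia.
have uJ N : core M eta (u N).
  elim: N => [|N IH]; first by rewrite /u x0.
  by rewrite uS; case: (digP (c N, u N) (c_neq N) IH).
exists a, u; split=> //; first by rewrite /u x0.
pose K := 4 * n.+1%:R / ((beta - 1) * eta) * M.+1%:R + 2 * n%:R.
have [d0 _ _ dh _] := margin_bounds mg.
apply: (debt_sublinear _ (K / n.+1%:R)).
- by rewrite divr_ge0// /K addr_ge0// !mulr_ge0// invr_ge0 ltW.
- by move=> k; rewrite /debt big_ord0 mul0r subrr.
- by move=> N k; exact: debt_drift.
move=> j; set D := debt p a (j ^ 2); pose W : R := (j ^ 2)%:R.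
have DW i : `|D i| <= W by exact: debt_le.
have top_D := topP D; set kl := top D in top_D; have [_ Dlk _] := top_D.
pose P := potential beta eta n D W kl.1 kl.2.
have run m : (m <= 2 * j + 1)%N ->
    n.+1%:R * (\sum_k D k * (debt p a (j ^ 2 + m) k - D k))
      <= P (u (j ^ 2)%N) - P (u (j ^ 2 + m)%N).
  elim: m => [|m IH] mj.
    rewrite addn0 big1 ?mulr0 ?subrr// => k _.
    by rewrite -/D subrr mulr0.
  have {}IH := IH (ltnW mj); have mj' : (m <= 2 * j)%N by lia.
  have := digP (c (j ^ 2 + m)%N, u (j ^ 2 + m)%N) (c_neq _) (uJ _).
  rewrite -/(a (j ^ 2 + m)%N) /= cD// -uS => -[_ /(_ D W Dlk DW)].
  rewrite -/D -/kl -/P addnS => pot.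
  have := top_pair_ge n D p kl top_D p01 p1.
  have -> : \sum_k D k * (debt p a (j ^ 2 + m).+1 k - D k) =
      \sum_k D k * (debt p a (j ^ 2 + m) k - D k)
      + (\sum_k D k * p k - D (a (j ^ 2 + m)%N)).
    rewrite [X in _ - X](_ : _ = \sum_k D k * (a (j ^ 2 + m)%N == k)%:R).
      rewrite -sumrB -big_split /=; apply: eq_bigr => k _; rewrite debtS; ring.
    rewrite (bigD1 (a (j ^ 2 + m)%N))//= eqxx mulr1 big1 ?addr0// => k.
    by rewrite eq_sym => /negbTE->; rewrite mulr0.
  lra.
have n0 : 0 < n.+1%:R :> R by [].
rewrite -mulrA [_^-1 * _]mulrC mulrA ler_pdivlMr// mulrC.
have -> : (j.+1 ^ 2 = j ^ 2 + (2 * j + 1))%N by lia.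
apply: le_trans (run _ (leqnn _)) _; rewrite [K * _]mulrC.
exact: potential_drop.
Qed.

Theorem theorem1p2 (R : realType) (M n : nat) (beta : R) :
  (0 < M)%N -> (0 < n)%N -> 1 < beta < beta_ R n ->
  forall x : R, 0 < x < M%:R / (beta - 1) ->
    Delta_eps M (n.+1%:R^-1 : R) `<=` Delta_beta M beta x.
Proof.
move=> M0 n0 bn x /andP[x0 xM] p [p01 p1].
have [/andP[_ b2] _] := beta_P R n0; have /andP[b1 bb] := bn.
have d0 : 0 < beta - 1 by rewrite subr_gt0.
pose u0 := (beta - 1) * x.
have u00 : 0 < u0 by rewrite mulr_gt0.
have u0M : u0 < M%:R by rewrite /u0 mulrC -ltr_pdivlMr.
have [|||eta mg] := @exists_margin R n beta (Num.min u0 (M%:R - u0)).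
- by rewrite b1 (lt_trans bb).
- exact: beta_expn_lt1.
- by rewrite lt_min u00 subr_gt0.
rewrite le_min => /andP[eta0 etaM].
have [_ _ h0 _ _] := margin_bounds mg.
have u0J : core M eta u0 by rewrite /core; lra.
have [a [u [uE uS uJ ap]]] := balanced_orbit (fun k => p 0 k) u0 mg M0 p01 p1 u0J.
split; first by split=> // k; case/andP: (p01 k).
exists a; last by move=> k; apply: (debt_has_freq (fun k => p 0 k)).
apply: (bounded_orbit_expansion beta x M%:R a u) => // N.
by have := uJ N; rewrite /core; lra.
Qed.
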